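(* Let $q$ be an odd prime power, let $d$ be odd, let $i \in \{3,4\}$, let $P \subseteq \mathbb{F}_q^d$, and let $S$ be a set of $Q_i^d$-spheres all of radius zero. Then \[\left|I(P,S) - q^{-1}|P|\,|S|\right| < \left((1+\sqrt{2})\,q^{d-1}|P|\,|S|\right)^{1/2}.\]
   Context: $\mathbb{F}_q$ is the finite field with $q$ elements. Fix a non-square $\epsilon\in\mathbb{F}_q$. For odd $d$, define quadratic forms on $\mathbb{F}_q^d$ by $Q_3^d(x) = x_1x_2 + x_3x_4 + \cdots + x_{d-2}x_{d-1} - x_d^2$ and $Q_4^d(x) = x_1x_2 + x_3x_4 + \cdots + x_{d-2}x_{d-1} - \epsilon x_d^2$. For a quadratic form $Q$, the $Q$-sphere with center $y$ and radius $r$ is $\{x \in \mathbb{F}_q^d : Q(x-y) = r\}$; a sphere is specified by its center and radius. For $P \subseteq \mathbb{F}_q^d$ and a set $S$ of spheres, $I(P,S) = \#\{(x,s) \in P \times S : x \in s\}$.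
   Formalization: P and S are assumed nonempty: if either is empty, both sides of the strict inequality are 0 and the claim as printed fails. *)

(* Defs.v *)
From mathcomp Require Import all_boot all_order all_algebra.

Set Implicit Arguments.
Unset Strict Implicit.
Unset Printing Implicit Defensive.

Import GRing.Theory.
Local Open Scope ring_scope.

(* Coordinates are numbered from 0: [coord x k] is x_(k+1); it is 0 when the
   index is out of range. *)
Definition coord (F : finFieldType) (d : nat) (x : 'rV[F]_d) (k : nat) : F :=
  if insub k is Some i then x 0 i else 0.

(* x_1 x_2 + x_3 x_4 + ... + x_(d-2) x_(d-1) - c x_d ^ 2, for odd d; the value
   for even d is not meaningful. *)
Definition hyperbolic_minus (F : finFieldType) (d : nat) (c : F)
    (x : 'rV[F]_d) : F :=
  \sum_(k < d./2) coord x k.*2 * coord x k.*2.+1 - c * coord x d.-1 ^+ 2.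

Definition Q3 (F : finFieldType) (d : nat) : 'rV[F]_d -> F :=
  hyperbolic_minus 1.

Definition Q4 (F : finFieldType) (d : nat) (eps : F) : 'rV[F]_d -> F :=
  hyperbolic_minus eps.

(* A sphere is the pair of its center and its radius, so that spheres with
   distinct data count as distinct even if they have the same points. *)
Definition sphere (F : finFieldType) (d : nat) :=
  ('rV[F]_d * F)%type.

Definition center (F : finFieldType) (d : nat) (s : sphere F d) : 'rV[F]_d :=
  s.1.

Definition radius (F : finFieldType) (d : nat) (s : sphere F d) : F := s.2.

Definition sphere_points (F : finFieldType) (d : nat) (Q : 'rV[F]_d -> F)
    (s : sphere F d) : {set 'rV[F]_d} :=
  [set x | Q (x - center s) == radius s].

Definition incidences (F : finFieldType) (d : nat) (Q : 'rV[F]_d -> F)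
    (P : {set 'rV[F]_d}) (S : {set sphere F d}) : nat :=
  #|[set u : 'rV[F]_d * sphere F d |
      [&& u.1 \in P, u.2 \in S & u.1 \in sphere_points Q u.2]]|.

(* Main.v *)
(* For y in F^d consider the "null points" adjacent to y: the points x with
   Q(x - y) = 0, each with weight q - 1, and the hyperplanes B(m, .) = t through
   y with m isotropic (m = 0 included).  These are the affine part and the part
   at infinity of the cone Q(m) = lambda t, i.e. of the conformal
   compactification of F^d.  Any two distinct y, z have the same weighted
   number q^(d-1) of common null points.  Hence the weighted variance, over all
   null points, of the number of adjacent elements of A is exactly
   (q - 1) q^(d-1) |A|; dropping the part at infinity leaves
   sum_x (a(x) - |A| / q)^2 <= q^(d-1) |A|, where a(x) is the number of y in A
   with Q(x - y) = 0.  Cauchy-Schwarz over x in P gives the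
   bound with constant 1 in place of 1 + sqrt 2. *)
From mathcomp Require Import all_boot all_order all_fingroup all_algebra.
From mathcomp Require Import cyclic ring zify.
Require Import Defs.

Import Order.TTheory GRing.Theory Num.Theory.
Local Open Scope ring_scope.

(** * Characteristic and fibre counting *)

Lemma odd_card_2neq0 (F : finFieldType) : odd #|F| -> 2 != 0 :> F.
Proof.
apply: contraTneq => F2; rewrite -dvdn2 -cardsT.
(* If 2 = 0, then 1 has additive order 2, which divides [#|F|] by Lagrange. *)
have <- : #[1%R : F]%g = 2%N.
  apply/(prime_nt_dvdP (isT : prime 2)).
    by rewrite order_eq1; exact: (oner_neq0 F).
  by rewrite order_dvdn FinRing.zmodXgE; apply/eqP.
exact: (@order_dvdG _ [set: F]%G) (in_setT _).
Qed.

(** Since [g s] shifts the value of [f] by [s] and is undone by [g (- s)], the map (s, u) to [g s u]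
    is a bijection from [F] times the zero fibre of [f] onto [A]. *)
Lemma card_equidistributed {F : finFieldType} {T : finType} (A : {set T})
    (f : T -> F) (g : F -> T -> T) :
    (forall s u, u \in A -> g s u \in A) ->
    (forall s u, u \in A -> f (g s u) = f u + s) ->
    (forall s u, u \in A -> g (- s) (g s u) = u) ->
  #|A| = (#|F| * #|[set u in A | f u == 0%R]|)%N.
Proof.
move=> gA fg gK; rewrite -cardsT -cardsX.
rewrite -(@card_in_imset _ _ (fun p : F * T => g p.1 p.2)); last first.
  move=> [s u] [t v]; rewrite !inE /= => /andP[uA /eqP fu] /andP[vA /eqP fv] e.
  have st : s = t by rewrite -[s]add0r -fu -fg // e fg // fv add0r.
  by rewrite -(gK s u) // e st gK.
apply: eq_card => u; apply/idP/imsetP => [uA|[[s v]]]; last first.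
  by rewrite !inE /= => /andP[vA _] ->; exact: gA.
exists (f u, g (- f u) u); last by rewrite /= -[LHS](gK (- f u)) // opprK.
by rewrite !inE /= gA // fg // subrr /=.
Qed.

(** * Second moments and Cauchy-Schwarz *)

Section Sums.
Context {R : realFieldType}.

Lemma natr_card_setI {T : finType} (A : {set T}) (p : pred T) :
  #|[set x in A | p x]|%:R = \sum_(x in A) (p x)%:R :> R.
Proof.
rewrite -sum1_card natr_sum [RHS]big_mkcond /= [LHS]big_mkcond /=.
by apply: eq_bigr => x _; rewrite inE; case: (x \in A); case: (p x).
Qed.

(** Double counting: the squared counts sum to the codegrees of pairs in [A], and the counts
    themselves to the degrees. *)
Lemma sum_sqr_deviation {I T : finType} (D : {set I}) (A : {set T})
    (e : I -> T -> bool) (c : R) :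
  \sum_(i in D) (#|[set y in A | e i y]|%:R - c) ^+ 2 =
  \sum_(x in A) \sum_(y in A) #|[set i in D | e i x && e i y]|%:R
  - 2 * c * (\sum_(x in A) #|[set i in D | e i x]|%:R) + c ^+ 2 * #|D|%:R.
Proof.
under eq_bigr do rewrite sqrrB.
rewrite big_split /= sumrB; congr (_ - _ + _).
- under [in LHS]eq_bigr do rewrite natr_card_setI expr2 big_distrlr.
  rewrite exchange_big; apply: eq_bigr => x _.
  rewrite exchange_big; apply: eq_bigr => y _.
  by rewrite natr_card_setI; apply: eq_bigr => i _; rewrite /= -natrM mulnb.
- under [in RHS]eq_bigr do rewrite natr_card_setI.
  rewrite exchange_big mulr_sumr; apply: eq_bigr => i _.
  by rewrite -natr_card_setI; ring.
- by rewrite sumr_const mulr_natr.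
Qed.

Lemma sqr_sum_le {T : finType} (A : {set T}) (f : T -> R) :
  (\sum_(x in A) f x) ^+ 2 <= #|A|%:R * \sum_(x in A) f x ^+ 2.
Proof.
have [->|A0] := eqVneq A set0; first by rewrite !big_set0 expr0n mulr0.
have p0 : 0 < #|A|%:R :> R by rewrite ltr0n card_gt0.
set T1 := \sum_(x in A) f x; set T2 := \sum_(x in A) _.
(* This sum equals [#|A|] times the difference of the two sides of the claim. *)
have : 0 <= \sum_(x in A) (#|A|%:R * f x - T1) ^+ 2.
  by apply: sumr_ge0 => x _; exact: sqr_ge0.
under eq_bigr do rewrite sqrrB exprMn.
rewrite big_split /= sumrB -mulr_sumr sumrMnl -mulr_suml -mulr_sumr -/T1 -/T2.
rewrite sumr_const -mulr_natr => h.
rewrite -(ler_pM2l p0) -subr_ge0; apply: le_trans h _.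
by rewrite le_eqVlt; apply/orP; left; apply/eqP; ring.
Qed.

End Sums.

(** * Isotropic vectors of a nondegenerate form in dimension [d.+1] *)

Section QuadraticCounts.
Context {F : finFieldType} {d : nat}.
Variables (Q : 'rV[F]_d.+1 -> F) (B : 'rV[F]_d.+1 -> 'rV[F]_d.+1 -> F).
Hypothesis QD : forall u v, Q (u + v) = Q u + B u v + Q v.
Hypothesis QZ : forall a u, Q (a *: u) = a ^+ 2 * Q u.
Hypothesis BD : forall u v w, B (u + v) w = B u w + B v w.
Hypothesis BZ : forall a u v, B (a *: u) v = a * B u v.
Hypothesis nondeg : forall v, v != 0 -> exists w, B w v != 0.
Hypothesis cardQ : #|[set u | Q u == 0%R]| = (#|F| ^ d)%N.

Notation q := #|F|.

Lemma polarC u v : B u v = B v u.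
Proof.
apply: (addrI (Q u)); apply: (addIr (Q v)).
by rewrite -QD addrC QD; ring.
Qed.

Lemma polar_diag v : B v v = 2 * Q v.
Proof.
apply: (addrI (Q v)); apply: (addIr (Q v)).
by rewrite -QD -mulr2n -scaler_nat QZ; ring.
Qed.

Lemma quad_sub u v : Q (u - v) = Q u - B u v + Q v.
Proof. by rewrite QD polarC -scaleN1r BZ QZ polarC; ring. Qed.

Lemma polarBr u v w : B u (v - w) = B u v - B u w.
Proof. by rewrite polarC BD -scaleN1r BZ mulN1r 2!(polarC u). Qed.

(** Off the hyperplane orthogonal to [v], [Q] is equidistributed, so its zeros there are known;
    subtracting from [cardQ] leaves those on the hyperplane. The factor [q] avoids the exponent d -
    1. *)
Lemma card_Q0_perp v : v != 0 -> Q v = 0 ->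
  (q * #|[set u | (Q u == 0%R) && (B u v == 0%R)]| = q ^ d)%N.
Proof.
move=> v0 Qv; have Bv : B v v = 0 by rewrite polar_diag Qv mulr0.
have [w Bw] := nondeg v v0.
have q0 : (0 < q)%N by apply/card_gt0P; exists 0.
have total : #|[set: 'rV[F]_d.+1]| = (q ^ d.+1)%N.
  by rewrite cardsT card_mx mul1n.
have perp : #|[set u | B u v == 0%R]| = (q ^ d)%N.
  apply/eqP; rewrite -(eqn_pmul2l q0) -expnS -total.
  rewrite (card_equidistributed setT (B^~ v) (fun s u => u + (s / B w v) *: w)).
  - by apply/eqP; congr (_ * _)%N; apply: eq_card => u; rewrite !inE.
  - by move=> *; rewrite inE.
  - by move=> s u _; rewrite BD BZ divfK.
  - by move=> s u _; rewrite mulNr scaleNr addrK.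
(* Translating u along the isotropic v changes Q(u) by multiples of B(u, v). *)
have nperp : #|[set u | B u v != 0]| =
    (q * #|[set u | (B u v != 0%R) && (Q u == 0%R)]|)%N.
  rewrite (card_equidistributed [set u | B u v != 0] Q
             (fun s u => u + (s / B u v) *: v)).
  - by congr (_ * _)%N; apply: eq_card => u; rewrite !inE.
  - by move=> s u; rewrite !inE BD BZ Bv mulr0 addr0.
  - move=> s u; rewrite inE => Bu.
    by rewrite QD QZ Qv polarC BZ (polarC v) divfK // mulr0 addr0.
  - move=> s u; rewrite inE => Bu.
    by rewrite BD BZ Bv mulr0 addr0 mulNr scaleNr addrK.
(* With z zeros of [Q] on the hyperplane and n off it, z + n = q^d and q^d + q n = q^(d+1); hence q
   z = q^d. *)
have cQ := cardsID [set u | B u v == 0] [set u | Q u == 0].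
have cT := cardsID [set u | B u v == 0] setT.
move: cQ cT; rewrite cardQ total setTI perp.
have -> : [set: 'rV[F]_d.+1] :\: [set u | B u v == 0] = [set u | B u v != 0].
  by apply/setP => u; rewrite !inE andbT.
have -> : [set u | Q u == 0] :\: [set u | B u v == 0] =
  [set u | (B u v != 0) && (Q u == 0)] by apply/setP => u; rewrite !inE.
have -> : [set u | Q u == 0] :&: [set u | B u v == 0] =
  [set u | (Q u == 0) && (B u v == 0)] by apply/setP => u; rewrite !inE.
rewrite nperp expnS; nia.
Qed.

(** If [Q v = 0], the two sets coincide and [card_Q0_perp] applies. Otherwise the first term counts,
    by rescaling, the isotropic vectors not orthogonal to [v], and the second the orthogonal
    ones. *)
Lemma card_common v : v != 0 ->
  (q.-1 * #|[set u | (Q u == 0%R) && (B u v == Q v)]| +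
   #|[set u | (Q u == 0%R) && (B u v == 0%R)]| = q ^ d)%N.
Proof.
move=> v0; have q0 : (0 < q)%N by apply/card_gt0P; exists 0.
have [Qv|Qv] := eqVneq (Q v) 0.
  by rewrite Qv -(card_Q0_perp v v0 Qv) -{2}(prednK q0) mulSn addnC.
rewrite -cardQ -(cardsID [set u | B u v == 0%R] [set u | Q u == 0%R]) [RHS]addnC.
congr (_ + _)%N; last first.
  by apply: eq_card => u; rewrite !inE.
have -> : q.-1 = #|[set a : F | a != 0]|.
  have := cardsC1 (0 : F); rewrite -[in RHS]subn1 => h; rewrite -subn1 -h.
  by apply: eq_card => u; rewrite !inE.
(* Isotropic u with B(u, v) <> 0 rescale uniquely to B(u, v) = Q(v). *)
rewrite -cardsX -(@card_in_imset _ _ (fun p : F * 'rV[F]_d.+1 => p.1 *: p.2)).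
  apply: eq_card => u; apply/imsetP/idP => [[[a w]]|].
    rewrite !inE /= => /and3P[a0 /eqP Qw /eqP Bw] ->.
    by rewrite QZ BZ Qw Bw mulr0 eqxx andbT mulf_neq0.
  rewrite !inE => /andP[Bu /eqP Qu].
  exists (B u v / Q v, (B u v / Q v)^-1 *: u) => /=.
    rewrite !inE /= QZ Qu mulr0 eqxx BZ invf_div divfK // eqxx !andbT.
    by rewrite mulf_neq0 ?invr_eq0.
  by rewrite scalerA divff ?scale1r // mulf_neq0 ?invr_eq0.
move=> [a u] [b w]; rewrite !inE /=.
move=> /and3P[a0 _ /eqP Bu] /and3P[b0 _ /eqP Bw] e.
have ab : a = b.
  by apply: (mulIf Qv); rewrite -{1}Bu -Bw -!BZ e.
by congr (_, _) => //; apply: (scalerI a0); rewrite e ab.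
Qed.

(** Put u = x - y and v = z - y: [Q (x - z) = 0] becomes [B u v = Q v]. A hyperplane (m, t) through
    both points has t = [B m y], leaving only [B m v = 0]. *)
Lemma card_common_translates y z : y != z ->
  (q.-1 * #|[set x in setT | (Q (x - y) == 0%R) && (Q (x - z) == 0%R)]| +
   #|[set w in setX [set u | Q u == 0%R] [set: F] |
       (B w.1 y == w.2) && (B w.1 z == w.2)]| = q ^ d)%N.
Proof.
move=> yz; rewrite -(card_common (z - y)) ?subr_eq0 1?eq_sym //.
congr (_ * _ + _)%N.
  rewrite -[RHS](card_imset _ (addIr y)); apply: eq_card => x.
  rewrite inE in_setT /=; apply/idP/imsetP => [/andP[/eqP Qy /eqP Qz]|[u]].
    exists (x - y); last by rewrite subrK.
    rewrite inE Qy eqxx /=; move: Qz.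
    have -> : x - z = (x - y) - (z - y) by rewrite opprB addrA subrK.
    by rewrite quad_sub Qy sub0r addrC => /eqP; rewrite subr_eq0 eq_sym.
  rewrite inE => /andP[/eqP Qu /eqP Bu] ->.
  rewrite addrK Qu eqxx /=.
  have -> : u + y - z = u - (z - y) by rewrite opprB addrA addrAC.
  by rewrite quad_sub Qu Bu sub0r addNr.
rewrite -[RHS](@card_imset _ _ (fun u => (u, B u y))); last by move=> u v [].
apply: eq_card => -[m t]; rewrite !inE andbT /=; apply/idP/imsetP => [|[u]].
  move=> /and3P[Qm /eqP <- /eqP Bz]; exists m => //.
  by rewrite inE Qm polarBr Bz subrr eqxx.
rewrite inE => /andP[Qu Bu] [-> ->]; rewrite Qu eqxx /=.
by rewrite -subr_eq0 -polarBr.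
Qed.

Lemma sum_sqr_deviation_cone {R : realFieldType} (A : {set 'rV[F]_d.+1}) :
  \sum_x (#|[set y in A | Q (x - y) == 0%R]|%:R - #|A|%:R / q%:R) ^+ 2
    <= q%:R ^+ d * #|A|%:R :> R.
Proof.
have q1 : (1 < q)%N := card_finNzRing_gt1 F.
have q0 : (0 < q)%N := ltnW q1.
have qR : q%:R != 0 :> R by rewrite pnatr_eq0 -lt0n.
have qd : q%:R ^+ d.+1 = q%:R * q%:R ^+ d :> R by rewrite exprS.
(* Both families, affine points and [D2], have q^(d+1) members, and each y is adjacent to q^d of
   either; so [c] is the mean count in both. *)
pose c : R := #|A|%:R / q%:R.
pose D2 := setX [set u | Q u == 0%R] [set: F].
pose e1 x y := Q (x - y) == 0.
pose e2 (w : 'rV[F]_d.+1 * F) y := B w.1 y == w.2.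
have deg1 y : #|[set x in [set: 'rV[F]_d.+1] | e1 x y]| = (q ^ d)%N.
  rewrite -cardQ -[RHS](card_imset _ (addIr y)); apply: eq_card => x.
  rewrite inE in_setT /=; apply/idP/imsetP => [Qx|[u]].
    by exists (x - y); rewrite ?subrK // inE.
  by rewrite inE /e1 => Qu ->; rewrite addrK.
have deg2 y : #|[set w in D2 | e2 w y]| = (q ^ d)%N.
  rewrite -cardQ -[RHS](@card_imset _ _ (fun u => (u, B u y))); last by move=> u v [].
  apply: eq_card => -[m t]; rewrite !inE andbT /=; apply/andP/imsetP => [[Qm]|[u]].
    by move=> /eqP /= <-; exists m => //; rewrite inE.
  by rewrite inE /e2 => Qu [-> ->] /=.
have cardT1 : #|[set: 'rV[F]_d.+1]| = (q ^ d.+1)%N by rewrite cardsT card_mx mul1n.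
have cardD2 : #|D2| = (q ^ d.+1)%N by rewrite cardsX cardQ cardsT expnSr.
(* Distinct pairs contribute q^d each by [card_common_translates]; a diagonal pair contributes (q -
   1) q^d more. *)
have codeg : q.-1%:R * (\sum_(x in A) \sum_(y in A)
      #|[set i in setT | e1 i x && e1 i y]|%:R) +
    \sum_(x in A) \sum_(y in A) #|[set i in D2 | e2 i x && e2 i y]|%:R =
    #|A|%:R * (#|A|%:R * q%:R ^+ d + (q%:R - 1) * q%:R ^+ d) :> R.
  rewrite mulr_sumr -big_split /= mulr_natl -sumr_const; apply: eq_bigr => x xA.
  rewrite mulr_sumr -big_split /=.
  transitivity (\sum_(y in A)
      (q%:R ^+ d + (if y == x then (q%:R - 1) * q%:R ^+ d else 0)) : R).
    apply: eq_bigr => y _; have [->|yx] := eqVneq y x; last first.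
      by rewrite addr0 -natrM -natrD card_common_translates 1?eq_sym // natrX.
    rewrite (eq_card (B := [set i in setT | e1 i x])); last first.
      by move=> i; rewrite !inE andbb.
    rewrite deg1 (eq_card (B := [set i in D2 | e2 i x])); last first.
      by move=> i; rewrite !inE andbb.
    by rewrite deg2 -subn1 natrB // natrX; ring.
  rewrite big_split /= sumr_const mulr_natl -big_mkcondr; congr (_ + _).
  by rewrite (big_pred1 x) // => y; rewrite /= andbC; case: eqP => // ->.
have E1 := sum_sqr_deviation [set: 'rV[F]_d.+1] A e1 c.
have E2 := sum_sqr_deviation D2 A e2 c.
have S1 : \sum_(x in A) #|[set i in setT | e1 i x]|%:R = #|A|%:R * q%:R ^+ d :> R.
  by under eq_bigr do rewrite deg1 natrX; rewrite sumr_const mulr_natl.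
have S2 : \sum_(x in A) #|[set i in D2 | e2 i x]|%:R = #|A|%:R * q%:R ^+ d :> R.
  by under eq_bigr do rewrite deg2 natrX; rewrite sumr_const mulr_natl.
rewrite S1 in E1; rewrite S2 in E2.
(* This deviation at infinity is exactly q - 1 times the slack in the claimed inequality, as
   eliminating [Y] through [codeg] shows. *)
have : 0 <= \sum_(i in D2) (#|[set y in A | e2 i y]|%:R - c) ^+ 2 :> R.
  by apply: sumr_ge0 => i _; exact: sqr_ge0.
rewrite (eq_bigl (fun x => x \in [set: 'rV[F]_d.+1])); last by move=> x; rewrite inE.
rewrite E1 E2 cardT1 cardD2.
rewrite -/c natrX => h.
have q1R : 0 < q%:R - 1 :> R by rewrite subr_gt0 ltr1n.
rewrite -(ler_pM2l q1R).
move: codeg h; rewrite -subn1 natrB // /c.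
set X := \sum_(x in A) _; set Y := \sum_(x in A) _ => codeg h.
rewrite -subr_ge0; apply: (le_trans h).
rewrite le_eqVlt; apply/orP; left; apply/eqP.
have -> : Y = #|A|%:R * (#|A|%:R * q%:R ^+ d + (q%:R - 1) * q%:R ^+ d)
    - (q%:R - 1) * X by rewrite -codeg addrAC subrr add0r.
by rewrite qd; field.
Qed.

End QuadraticCounts.

(** * The form [H]: [n] hyperbolic planes and the line with form - c x^2 *)

Section HyperbolicMinus.
Context {F : finFieldType} {n : nat}.
Variable c : F.
Hypothesis c_neq0 : c != 0.
Hypothesis two_neq0 : 2 != 0 :> F.

Implicit Types u v : 'rV[F]_(n.*2.+1).
Notation q := #|F|.
Notation H := (@hyperbolic_minus F n.*2.+1 c).

Definition hyperbolic_polar u v : F :=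
  \sum_(k < n) (coord u k.*2 * coord v k.*2.+1 + coord u k.*2.+1 * coord v k.*2)
  - 2 * c * coord u n.*2 * coord v n.*2.

Notation e j := (delta_mx 0 (inord j) : 'rV[F]_(n.*2.+1)).

Lemma coordE u k : (k < n.*2.+1)%N -> coord u k = u 0 (inord k).
Proof.
move=> lt_k; rewrite /coord insubT /=; congr (u 0 _).
by apply: val_inj; rewrite /= inordK.
Qed.

Lemma coordD u v k : coord (u + v) k = coord u k + coord v k.
Proof. by rewrite /coord; case: insubP => [i _ _|_]; rewrite ?mxE ?addr0. Qed.

Lemma coordZ a u k : coord (a *: u) k = a * coord u k.
Proof. by rewrite /coord; case: insubP => [i _ _|_]; rewrite ?mxE ?mulr0. Qed.

Lemma coord_delta j k : (j < n.*2.+1)%N -> (k < n.*2.+1)%N ->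
  coord (e j) k = (k == j)%:R.
Proof.
move=> lt_j lt_k; rewrite coordE // mxE eqxx /=.
by rewrite -val_eqE /= !inordK.
Qed.

Lemma hyperbolic_minusE u : H u =
  \sum_(k < n) coord u k.*2 * coord u k.*2.+1 - c * coord u n.*2 ^+ 2.
Proof. by rewrite /hyperbolic_minus /= uphalf_double. Qed.

Lemma hyperbolic_minusD u v : H (u + v) = H u + hyperbolic_polar u v + H v.
Proof.
rewrite !hyperbolic_minusE /hyperbolic_polar !coordD.
under eq_bigr => k _.
  rewrite !coordD (_ : (_ + _) * _ = coord u k.*2 * coord u k.*2.+1 +
    (coord u k.*2 * coord v k.*2.+1 + coord u k.*2.+1 * coord v k.*2) +
    coord v k.*2 * coord v k.*2.+1); last by ring.
over.
by rewrite !big_split /=; ring.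
Qed.

Lemma hyperbolic_minusZ a u : H (a *: u) = a ^+ 2 * H u.
Proof.
rewrite !hyperbolic_minusE coordZ mulrBr mulr_sumr; congr (_ - _); last by ring.
by apply: eq_bigr => k _; rewrite !coordZ; ring.
Qed.

Lemma hyperbolic_polarD u v w :
  hyperbolic_polar (u + v) w = hyperbolic_polar u w + hyperbolic_polar v w.
Proof.
rewrite /hyperbolic_polar coordD addrACA -opprD -big_split /=; congr (_ - _).
  by apply: eq_bigr => k _; rewrite !coordD; ring.
by ring.
Qed.

Lemma hyperbolic_polarZ a u v :
  hyperbolic_polar (a *: u) v = a * hyperbolic_polar u v.
Proof.
rewrite /hyperbolic_polar coordZ mulrBr mulr_sumr; congr (_ - _); last by ring.
by apply: eq_bigr => k _; rewrite !coordZ; ring.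
Qed.

Lemma hyperbolic_polar_last v :
  hyperbolic_polar (e n.*2) v = - (2 * c * coord v n.*2).
Proof.
rewrite /hyperbolic_polar coord_delta // eqxx mulr1 big1 ?sub0r // => k _.
have := ltn_ord k => lt_k.
rewrite !coord_delta; try lia.
have -> : (k.*2 == n.*2)%N = false by lia.
have -> : (k.*2.+1 == n.*2)%N = false by lia.
by rewrite !mul0r addr0.
Qed.

Lemma hyperbolic_polar_even (k : 'I_n) v :
  hyperbolic_polar (e k.*2) v = coord v k.*2.+1.
Proof.
have := ltn_ord k => lt_k.
rewrite /hyperbolic_polar coord_delta; try lia.
have -> : (n.*2 == k.*2)%N = false by lia.
rewrite mulr0 mul0r subr0 (bigD1 k) //= big1 => [|i ik].
  rewrite !coord_delta; try lia.
  have -> : (k.*2.+1 == k.*2)%N = false by lia.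
  by rewrite eqxx mul1r mul0r !addr0.
have := ltn_ord i => lt_i.
have ik' : (i != k :> nat) by [].
rewrite !coord_delta; try lia.
have -> : (i.*2 == k.*2)%N = false by lia.
have -> : (i.*2.+1 == k.*2)%N = false by lia.
by rewrite !mul0r addr0.
Qed.

Lemma hyperbolic_polar_odd (k : 'I_n) v :
  hyperbolic_polar (e k.*2.+1) v = coord v k.*2.
Proof.
have := ltn_ord k => lt_k.
rewrite /hyperbolic_polar coord_delta; try lia.
have -> : (n.*2 == k.*2.+1)%N = false by lia.
rewrite mulr0 mul0r subr0 (bigD1 k) //= big1 => [|i ik].
  rewrite !coord_delta; try lia.
  have -> : (k.*2 == k.*2.+1)%N = false by lia.
  by rewrite eqxx mul1r mul0r add0r addr0.
have := ltn_ord i => lt_i.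
have ik' : (i != k :> nat) by [].
rewrite !coord_delta; try lia.
have -> : (i.*2 == k.*2.+1)%N = false by lia.
have -> : (i.*2.+1 == k.*2.+1)%N = false by lia.
by rewrite !mul0r addr0.
Qed.

(** A nonzero coordinate of [v] is read off by its partner basis vector in the hyperbolic pair; the
    last coordinate is its own partner, with factor - 2 c, nonzero by hypothesis. *)
Lemma hyperbolic_polar_nondeg v : v != 0 -> exists w, hyperbolic_polar w v != 0.
Proof.
case/rV0Pn => j; have jn := ltn_ord j.
have -> : v 0 j = coord v j by rewrite coordE // inord_val.
move=> vj; have [j2n|j2n] := eqVneq (j : nat) n.*2.
  rewrite j2n in vj.
  by exists (e n.*2); rewrite hyperbolic_polar_last oppr_eq0 !mulf_neq0.
have lt_j : (j./2 < n)%N by lia.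
have [oj|ej] := boolP (odd j).
  exists (e (Ordinal lt_j).*2); rewrite hyperbolic_polar_even /=.
  by have <- : (j : nat) = j./2.*2.+1 by lia.
exists (e (Ordinal lt_j).*2.+1); rewrite hyperbolic_polar_odd /=.
by have <- : (j : nat) = j./2.*2 by lia.
Qed.

Lemma hyperbolic_minus_odd0 (k : 'I_n) : H (e k.*2.+1) = 0.
Proof.
have := ltn_ord k => lt_k.
rewrite hyperbolic_minusE big1 ?coord_delta; try lia; last first.
  move=> i _; have := ltn_ord i => lt_i; rewrite !coord_delta; try lia.
  have -> : (i.*2 == k.*2.+1)%N = false by lia.
  by rewrite mul0r.
have -> : (n.*2 == k.*2.+1)%N = false by lia.
by rewrite expr0n mulr0 subr0.
Qed.

Lemma card_hyperbolic_minus0 : #|[set u | H u == 0%R]| = (q ^ n.*2)%N.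
Proof.
have q0 : (0 < q)%N by apply/card_gt0P; exists 0.
(* Off the subspace where all even coordinates vanish, H is translated by moving
   an odd coordinate; on it, H is -c times the square of the last one. *)
pose nz u := [pick k : 'I_n | coord u k.*2 != 0].
pose A := [set u | nz u].
pose g s u := if nz u is Some k then u + (s / coord u k.*2) *: e k.*2.+1 else u.
(* [g] alters only an odd coordinate, so [nz] picks the same index before and after, which makes
   [g s] invertible. *)
have coord_g s u (k : 'I_n) : coord (g s u) k.*2 = coord u k.*2.
  rewrite /g; case: (nz u) => // i; have lt_k := ltn_ord k; have lt_i := ltn_ord i.
  rewrite coordD coordZ coord_delta; try lia.
  have -> : (k.*2 == i.*2.+1)%N = false by lia.
  by rewrite mulr0 addr0.
have nz_g s u : nz (g s u) = nz u by apply: eq_pick => k /=; rewrite coord_g.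
have cA : #|A| = (q * #|[set u in A | H u == 0%R]|)%N.
  apply: (card_equidistributed A H g) => s u; rewrite !inE ?nz_g //.
    rewrite /g /nz; case: pickP => // k uk _.
    rewrite hyperbolic_minusD hyperbolic_minusZ hyperbolic_minus_odd0 mulr0 addr0.
    rewrite (@polarC F n.*2 H hyperbolic_polar hyperbolic_minusD).
    by rewrite hyperbolic_polarZ hyperbolic_polar_odd divfK.
  rewrite {1}/g nz_g; case E : (nz u) => [k|] // _.
  by rewrite coord_g /g E mulNr scaleNr addrK.
(* The square in [H] is not equidistributed on [~: A], but the last coordinate is, and it has the
   same zeros there. *)
have cAC : #|~: A| = (q * #|[set u in ~: A | coord u n.*2 == 0%R]|)%N.
  have coord_h s u k : (k < n)%N -> coord (u + s *: e n.*2) k.*2 = coord u k.*2.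
    move=> lt_k; rewrite coordD coordZ coord_delta; try lia.
    have -> : (k.*2 == n.*2)%N = false by lia.
    by rewrite mulr0 addr0.
  apply: (card_equidistributed (~: A) (fun u => coord u n.*2)
            (fun s u => u + s *: e n.*2)).
  - move=> s u; rewrite !inE /nz; congr (~~ isSome _).
    by apply: eq_pick => k /=; rewrite coord_h.
  - by move=> s u _; rewrite coordD coordZ coord_delta // eqxx mulr1.
  - by move=> s u _; rewrite scaleNr addrK.
have HAC : [set u in ~: A | coord u n.*2 == 0%R] = [set u in ~: A | H u == 0%R].
  apply/setP => u; rewrite !inE /nz; case: pickP => //= u0.
  rewrite hyperbolic_minusE big1 ?sub0r => [|k _]; last first.
    by move/eqP: (u0 k) => ->; rewrite mul0r.
  by rewrite oppr_eq0 mulf_eq0 (negPf c_neq0) sqrf_eq0.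
have := cardsC A; rewrite cA cAC HAC card_mx mul1n expnS -mulnDr => /eqP.
rewrite eqn_pmul2l // => /eqP <-.
rewrite -(cardsID A); congr (_ + _)%N; apply: eq_card => u; rewrite !inE //.
exact: andbC.
Qed.

Lemma sum_sqr_deviation_hyperbolic {R : realFieldType}
    (A : {set 'rV[F]_(n.*2.+1)}) :
  \sum_x (#|[set y in A | H (x - y) == 0%R]|%:R - #|A|%:R / q%:R) ^+ 2
    <= q%:R ^+ n.*2 * #|A|%:R :> R.
Proof.
apply: (@sum_sqr_deviation_cone F n.*2 H hyperbolic_polar).
- exact: hyperbolic_minusD.
- exact: hyperbolic_minusZ.
- exact: hyperbolic_polarD.
- exact: hyperbolic_polarZ.
- exact: hyperbolic_polar_nondeg.
- exact: card_hyperbolic_minus0.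
Qed.

End HyperbolicMinus.

(** * Incidences with spheres of radius zero *)

Lemma incidencesE {F : finFieldType} {d : nat} (Q : 'rV[F]_d -> F)
    (P : {set 'rV[F]_d}) (S : {set sphere F d}) :
  incidences Q P S = (\sum_(x in P) #|[set s in S | x \in sphere_points Q s]|)%N.
Proof.
rewrite /incidences -sum1dep_card.
rewrite -(pair_big_dep (mem P) (fun x s => (s \in S) && (x \in sphere_points Q s))
            (fun _ _ => 1%N)) /=.
by apply: eq_bigr => x _; rewrite sum1dep_card.
Qed.

(** With the radius fixed, a sphere is determined by its center, so [S] may be replaced by its set
    of centers. *)
Lemma incidences_radius0 {F : finFieldType} {d : nat} (Q : 'rV[F]_d -> F)
    (P : {set 'rV[F]_d}) (S : {set sphere F d}) :
    (forall s, s \in S -> radius s = 0) ->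
  exists2 A : {set 'rV[F]_d}, #|A| = #|S| &
    incidences Q P S = (\sum_(x in P) #|[set y in A | Q (x - y)%R == 0%R]|)%N.
Proof.
move=> S0; have injS : {in S &, injective (@center F d)}.
  move=> [y r] [z t] /S0 /= r0 /S0 /= t0 /= yz.
  by move: r0 t0 yz; rewrite /radius /center /= => -> -> ->.
exists (@center F d @: S); first exact: card_in_imset.
rewrite incidencesE; apply: eq_bigr => x _.
rewrite -(@card_in_imset _ _ (@center F d)); last first.
  by move=> s t /setIdP[sS _] /setIdP[tS _]; exact: injS.
apply: eq_card => y; apply/imsetP/setIdP => [[s]|[/imsetP[s sS ->] Qs]].
  rewrite !inE => /andP[sS Qs] ->; split; first exact: imset_f.
  by rewrite -(S0 s sS).
by exists s; rewrite // !inE sS S0.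
Qed.

Theorem theorem4p2 (R : rcfType) (F : finFieldType) (q : nat)
    (card_F : #|F| = q) (odd_q : odd q)
    (eps : F) (eps_nonsquare : forall a : F, a ^+ 2 != eps)
    (d : nat) (odd_d : odd d)
    (Q : 'rV[F]_d -> F) (Q_3_or_4 : Q = @Q3 F d \/ Q = @Q4 F d eps)
    (P : {set 'rV[F]_d}) (S : {set sphere F d})
    (P_nonempty : P != set0) (S_nonempty : S != set0)
    (radius0 : forall s : sphere F d, s \in S -> radius s = 0) :
  `|(incidences Q P S)%:R - (q%:R)^-1 * #|P|%:R * #|S|%:R| <
  Num.sqrt ((1 + Num.sqrt 2) * q%:R ^+ d.-1 * #|P|%:R * #|S|%:R) :> R.
Proof.
have two_neq0 : 2 != 0 :> F by apply: odd_card_2neq0; rewrite card_F.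
(* [eps] is nonzero because 0 is a square. *)
have [c c0 QE] : exists2 c : F, c != 0 & Q = @hyperbolic_minus F d c.
  case: Q_3_or_4 => ->; [exists 1 => //; exact: oner_neq0|exists eps => //].
  by have := eps_nonsquare 0; rewrite expr0n eq_sym.
have [n dE] : exists n, d = n.*2.+1 by exists d./2; lia.
subst d Q => /=.
have [A cardA ->] := incidences_radius0 (hyperbolic_minus c) P S radius0.
have q0 : 0 < q%:R :> R by rewrite ltr0n -card_F; apply/card_gt0P; exists 0.
have P0 : 0 < #|P|%:R :> R by rewrite ltr0n card_gt0.
have S0 : 0 < #|S|%:R :> R by rewrite ltr0n card_gt0.
have K0 : 0 < q%:R ^+ n.*2 * #|P|%:R * #|S|%:R :> R by rewrite !mulr_gt0 ?exprn_gt0.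
pose f x : R := #|[set y in A | hyperbolic_minus c (x - y) == 0%R]|%:R - #|A|%:R / q%:R.
have -> : (\sum_(x in P) #|[set y in A | hyperbolic_minus c (x - y)%R == 0%R]|)%:R
    - q%:R^-1 * #|P|%:R * #|S|%:R = \sum_(x in P) f x.
  rewrite sumrB natr_sum sumr_const -mulr_natr cardA; congr (_ - _); ring.
(* Cauchy-Schwarz over [P], then the sum of squares is enlarged from [P] to the whole space. *)
have bound : (\sum_(x in P) f x) ^+ 2 <= q%:R ^+ n.*2 * #|P|%:R * #|S|%:R.
  apply: le_trans (sqr_sum_le P f) _; rewrite mulrAC [leRHS]mulrC.
  rewrite ler_wpM2l ?ler0n // -cardA -card_F.
  apply: le_trans (sum_sqr_deviation_hyperbolic c c0 two_neq0 A).
  rewrite [leRHS](bigID (mem P)) /= card_F lerDl.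
  by apply: sumr_ge0 => x _; exact: sqr_ge0.
(* Squares are compared; strictness comes from 1 < 1 + sqrt 2 and [K0], which holds as [P] and [S]
   are nonempty. *)
rewrite -sqrtr_sqr ltr_sqrt; last first.
  by rewrite -!mulrA mulr_gt0 ?ltr_wpDr ?sqrtr_ge0 // !mulrA.
apply: le_lt_trans bound _; rewrite -!mulrA ltr_pMl ?ltrDl ?sqrtr_gt0 //.
by rewrite !mulrA.
Qed.
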